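(* Let $R$ be a separative exchange ring. Then every matrix in $\mathrm{GL}_2(R)$ can be reduced to a diagonal matrix using four elementary operations.
   Context: Rings are associative and unital. A ring $R$ is an exchange ring if the right module $R_R$ has the finite exchange property; equivalently, for every $a\in R$ there is an idempotent $e\in aR$ with $1-e\in (1-a)R$. $\mathrm{FP}(R)$ denotes the category of finitely generated projective right $R$-modules. An exchange ring $R$ is separative if for all $A,B,C\in\mathrm{FP}(R)$, $A\oplus C\oplus C\cong B\oplus C\oplus C$ implies $A\oplus C\cong B\oplus C$ (equivalently, $A\oplus A\cong A\oplus B\cong B\oplus B$ implies $A\cong B$ for all $A,B\in \mathrm{FP}(R)$). A $2\times 2$ elementary matrix is one of the form $\begin{bmatrix}1 & x\\ 0 & 1\end{bmatrix}$ or $\begin{bmatrix}1 & 0\\ x & 1\end{bmatrix}$ with $x\in R$; an elementary row (respectively column) operation is left (respectively right) multiplication by an elementary matrix, and an elementary operation is an elementary row or column operation (the identity operation is allowed). *)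

(* Defs.v *)
From HB Require Import structures.
From mathcomp Require Import all_boot all_algebra.

Set Implicit Arguments.
Unset Strict Implicit.
Unset Printing Implicit Defensive.

Import GRing.Theory.
Local Open Scope ring_scope.

(* Right R-modules are represented as left modules over the converse ring     *)
(* R^c. Rings may be zero, hence pzRingType.                                  *)

Section Modules.
Variable S : pzRingType.

Definition lmod_iso (U V : lmodType S) : Prop :=
  exists f : {linear U -> V}, bijective f.

Definition fin_generated (M : lmodType S) : Prop :=
  exists n (g : 'I_n -> M),
    forall x : M, exists c : 'I_n -> S, x = \sum_(i < n) c i *: g i.

Definition projective (M : lmodType S) : Prop :=
  forall (U V : lmodType S) (p : {linear U -> V}) (f : {linear M -> V}),
    (forall v : V, exists u : U, p u = v) ->
    exists h : {linear M -> U}, forall x : M, p (h x) = f x.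

Definition FP (M : lmodType S) : Prop := fin_generated M /\ projective M.

Definition is_direct_sum (G : lmodType S) (I : finType)
    (A : I -> {pred G}) : Prop :=
  [/\ forall i, submod_closed (A i),
      forall x : G, exists2 u : I -> G,
        forall i, u i \in A i & x = \sum_i u i
    & forall u : I -> G, (forall i, u i \in A i) -> \sum_i u i = 0 ->
        forall i, u i = 0].

(* Whenever G = M' (+) N = A_1 (+) ... (+) A_n with M' isomorphic to M, there *)
(* are submodules A'_i of A_i with G = M' (+) A'_1 (+) ... (+) A'_n. The      *)
(* isomorphism is f : M -> G, injective with image M'; in the last direct sum *)
(* the summand M' has index None.                                             *)
Definition finite_exchange (M : lmodType S) : Prop :=
  forall (G : lmodType S) (f : {linear M -> G}) (M' N : {pred G})
         (n : nat) (A : 'I_n -> {pred G}),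
    injective f ->
    (forall x : G, x \in M' <-> exists m : M, x = f m) ->
    is_direct_sum (fun b : bool => if b then M' else N) ->
    is_direct_sum A ->
    exists2 A' : 'I_n -> {pred G},
      forall i, {subset A' i <= A i}
      & is_direct_sum (fun o : option 'I_n => if o is Some i then A' i else M').

End Modules.

Section Rings.
Variable R : pzRingType.

(* R^c^o, as a left R^c-module, is the right module R_R.                      *)
Definition exchange_ring : Prop := finite_exchange (R^c^o : lmodType R^c).

Definition separative_exchange_ring : Prop :=
  exchange_ring /\
  forall A B C : lmodType R^c, FP A -> FP B -> FP C ->
    lmod_iso (A * C * C)%type (B * C * C)%type ->
    lmod_iso (A * C)%type (B * C)%type.

Definition mx2 (a b c d : R) : 'M[R]_2 :=
  \matrix_(i, j) if i == 0 then (if j == 0 then a else b)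
                 else (if j == 0 then c else d).

Definition elementary2 (E : 'M[R]_2) : Prop :=
  exists x : R, E = mx2 1 x 0 1 \/ E = mx2 1 0 x 1.

Definition elementary_op (A B : 'M[R]_2) : Prop :=
  exists2 E : 'M[R]_2, elementary2 E & B = E *m A \/ B = A *m E.

(* unitmx is only available over commutative rings.                           *)
Definition GL2 (A : 'M[R]_2) : Prop :=
  exists2 B : 'M[R]_2, A *m B = 1%:M & B *m A = 1%:M.

End Rings.

(* Main.v *)
Require Import Defs.
From HB Require Import structures.
From mathcomp Require Import all_boot all_algebra.
From Corelib Require Import Setoid Morphisms.

Set Implicit Arguments.
Unset Strict Implicit.
Unset Printing Implicit Defensive.

Import GRing.Theory.
Local Open Scope ring_scope.

(** Let P be an invertible 2 x 2 matrix, M = R^2, and consider two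
    decompositions of M: the standard one M = L1 + L2, and M = B1 + B2 where
    Bi = P Li. Multiplying P by an elementary matrix replaces one summand of
    one of these decompositions by another complement of the other summand,
    and P is diagonal when the decompositions agree. Hence four operations
    suffice once there are submodules X and Y with
        M = L1 + X = X + Y = Y + B2    (direct sums).
    In entries, Y is spanned by P (1, x)^T, X is the kernel of a row (1, z),
    and X + Y = M says that (1, z) P (1, x)^T is a unit: two operations put a
    unit in the corner, and two more clear its row and its column.

    To find X and Y, apply the exchange property of L1 = R to M = B1 + B2. It
    gives B1 = Q + A and B2 = B + K such that L1 is a complement of Q + B, so
    that L1 is the graph of a map (al, be) : A + K -> Q + B. Comparing
    complements,
        R = Q + A = K + A = Q + B = K + B    (up to isomorphism).
    Were K and Q isomorphic, Y = Q + A would do, up to a shift along be. In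
    general they become so only after adding a module U, and U can be absorbed
    if it is a summand of both A and B: write A = U + A0 and B = U + B0, tilt
    the copy of U in A towards the copy of U in B, and exchange the summand
    K + U of L1 with the summand Q + U of Y (graph_bridge).

    It remains to find U (common_summand). By refinement, A splits into a part
    below K and a part below B; move to the second part as much of the first
    as still embeds in B. The rest A0 of A is then a summand of K, hence of
    K + U, and also of Q + U, where U is the second part. Since
    K + U + A0 = R = Q + U + A0, separative cancellation of A0 gives
    K + U = Q + U. *)

(** * Linear maps into and out of direct sums *)

Section LinearMaps.
Variables (S : pzRingType) (U V W : lmodType S).

Definition pairf (f : U -> V) (g : U -> W) (x : U) := (f x, g x).

Lemma pairf_linear (f : {linear U -> V}) (g : {linear U -> W}) :
  linear (pairf f g).
Proof. by move=> c x y; rewrite /pairf !linearP. Qed.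

HB.instance Definition _ (f : {linear U -> V}) (g : {linear U -> W}) :=
  GRing.isLinear.Build _ _ _ _ _ (pairf_linear f g).

Definition sumf (f : U -> W) (g : V -> W) : U * V -> W :=
  (f \o fst) \+ (g \o snd).

HB.instance Definition _ (f : {linear U -> W}) (g : {linear V -> W}) :=
  GRing.Linear.copy (sumf f g) ((f \o fst) \+ (g \o snd)).

End LinearMaps.

Arguments pairf _ _ _ _ _ _ _ /.
Arguments sumf _ _ _ _ _ _ _ /.

(** * Isomorphism of modules and direct sums *)

Section Isomorphism.
Variable S : pzRingType.
Implicit Types U V W X : lmodType S.

Lemma linear_inverse U V (f : {linear U -> V}) :
  bijective f -> exists g : {linear V -> U}, cancel f g /\ cancel g f.
Proof.
case=> g fK gK.
pose g' : {linear V -> U} :=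
  HB.pack g (GRing.isLinear.Build _ _ _ _ _ (can2_linear fK gK)).
by exists g'.
Qed.

Lemma lmod_isoP U V :
  lmod_iso U V <->
  exists (f : {linear U -> V}) (g : {linear V -> U}), cancel f g /\ cancel g f.
Proof.
split=> [[f /linear_inverse[g fgK]] | [f [g [fK gK]]]]; first by exists f, g.
by exists f, g.
Qed.

Lemma lmod_iso_refl U : lmod_iso U U.
Proof. by exists idfun, idfun. Qed.

Lemma lmod_iso_sym U V : lmod_iso U V -> lmod_iso V U.
Proof. by case/lmod_isoP=> f [g [fK gK]]; exists g, f. Qed.

Lemma lmod_iso_trans U V W : lmod_iso U V -> lmod_iso V W -> lmod_iso U W.
Proof. by case=> f bf [g bg]; exists (g \o f); apply: bij_comp. Qed.

(** The product, as a constant on bundled modules, so that isomorphisms can be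
    rewritten inside direct sums. *)
Definition dsum U V : lmodType S := (U * V)%type.

Lemma dsum_iso U U' V V' :
  lmod_iso U U' -> lmod_iso V V' -> lmod_iso (dsum U V) (dsum U' V').
Proof.
case/lmod_isoP=> f [f' [fK f'K]] /lmod_isoP[g [g' [gK g'K]]].
exists (pairf (f \o fst) (g \o snd)); exists (pairf (f' \o fst) (g' \o snd)).
  by case=> x y /=; rewrite fK gK.
by case=> x y /=; rewrite f'K g'K.
Qed.

Lemma dsumC U V : lmod_iso (dsum U V) (dsum V U).
Proof. by exists (pairf snd fst); exists (pairf snd fst); case. Qed.

Lemma dsumA U V W : lmod_iso (dsum U (dsum V W)) (dsum (dsum U V) W).
Proof.
exists (pairf (pairf fst (fst \o snd)) (snd \o snd)).
by exists (pairf (fst \o fst) (pairf (snd \o fst) snd)) => [[? []]|[[]]].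
Qed.

End Isomorphism.

Add Parametric Relation (S : pzRingType) : (lmodType S) (@lmod_iso S)
  reflexivity proved by (@lmod_iso_refl S)
  symmetry proved by (@lmod_iso_sym S)
  transitivity proved by (@lmod_iso_trans S) as lmod_iso_rel.

Add Parametric Morphism (S : pzRingType) : (@dsum S)
  with signature (@lmod_iso S) ==> (@lmod_iso S) ==> (@lmod_iso S)
  as dsum_mor.
Proof. by move=> U U' iU V V' iV; apply: dsum_iso. Qed.

#[local] Hint Resolve lmod_iso_refl : core.

(** * Finitely generated projective modules *)

Section FinGenProjective.
Variable S : pzRingType.
Implicit Types U V W X : lmodType S.

Lemma FP_regular : FP (S^o : lmodType S).
Proof.
split=> [|U V p f p_surj].
  by exists 1, (fun=> 1) => x; exists (fun=> x); rewrite big_ord1 [_ *: _]mulr1.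
have [u pu] := p_surj (f 1).
have h_lin : linear (fun x : S^o => (x : S) *: u).
  by move=> c x y; rewrite scalerDl scalerA.
pose h : {linear S^o -> U} := HB.pack (fun x : S^o => (x : S) *: u)
  (GRing.isLinear.Build _ _ _ _ _ h_lin).
by exists h => x; rewrite /= linearZ /= pu -linearZ /= [_ *: _]mulr1.
Qed.

Lemma FP_retract U V (i : {linear U -> V}) (p : {linear V -> U}) :
  cancel i p -> FP V -> FP U.
Proof.
move=> iK [[n [g gen]] projV]; split=> [|X Y q f q_surj].
  exists n, (p \o g) => x; have [c ix] := gen (i x); exists c.
  by rewrite -[LHS]iK ix linear_sum; apply: eq_bigr => j _; rewrite linearZ.
have [h hE] := projV X Y q (f \o p) q_surj.
by exists (h \o i) => x; rewrite /= hE /= iK.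
Qed.

Lemma FP_iso U V : lmod_iso U V -> FP U -> FP V.
Proof. by case/lmod_isoP=> f [g [_ gK]]; apply: FP_retract gK. Qed.

Lemma FP_dsuml U V : FP (dsum U V) -> FP U.
Proof.
by apply: (@FP_retract U (dsum U V) (pairf idfun \0) fst).
Qed.

Lemma FP_dsumr U V : FP (dsum U V) -> FP V.
Proof. by move/(FP_iso (dsumC U V))/FP_dsuml. Qed.

Lemma FP_dsum U V : FP U -> FP V -> FP (dsum U V).
Proof.
move=> [[m [g gen_g]] projU] [[n [k gen_k]] projV].
split=> [|X Y q f q_surj].
  exists (m + n)%N, (fun l => match split l with
     | inl i => (g i, 0) | inr j => (0, k j) end).
  case=> x y; have [c cE] := gen_g x; have [d dE] := gen_k y.
  exists (fun l => match split l with inl i => c i | inr j => d j end).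
  rewrite big_split_ord /=.
  rewrite (eq_bigr (fun i => (c i *: g i, 0))); last first.
    move=> i _; rewrite (unsplitK (inl i)).
    by rewrite -[LHS]/(c i *: g i, c i *: 0) scaler0.
  rewrite [X in _ = _ + X](eq_bigr (fun j => (0, d j *: k j))); last first.
    move=> j _; rewrite (unsplitK (inr j)).
    by rewrite -[LHS]/(d j *: 0, d j *: k j) scaler0.
  have <- : (x, 0) = \sum_i (c i *: g i, 0) :> dsum U V.
    rewrite cE -[LHS]/(pairf idfun (\0 : {linear U -> V}) _) linear_sum.
    by apply: eq_bigr.
  have <- : (0, y) = \sum_i (0, d i *: k i) :> dsum U V.
    rewrite dE -[LHS]/(pairf (\0 : {linear V -> U}) idfun _) linear_sum.
    by apply: eq_bigr.
  by rewrite -[RHS]/(x + 0, 0 + y) addr0 add0r.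
have [h1 h1E] := projU X Y q (f \o pairf idfun \0) q_surj.
have [h2 h2E] := projV X Y q (f \o pairf \0 idfun) q_surj.
exists (sumf h1 h2); case=> x y.
rewrite /= linearD h1E h2E /= -linearD.
by congr (f _); rewrite -[LHS]/(x + 0, 0 + y) addr0 add0r.
Qed.

End FinGenProjective.

(** * Submodules and complements *)

Section Submodule.
Variables (S : pzRingType) (G : lmodType S) (P : {pred G}).

(** Carrying the closure proof lets the submodule structure be inferred from
    the predicate, for predicates that only come with such a proof. *)
Definition closed_pred (clP : submod_closed P) : {pred G} := P.

Variable clP : submod_closed P.

HB.instance Definition _ :=
  GRing.isSubmodClosed.Build S G (closed_pred clP) clP.

Record submod := Submod {submod_val : G; _ : submod_val \in closed_pred clP}.

HB.instance Definition _ := [isSub for submod_val].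
HB.instance Definition _ := [Choice of submod by <:].
HB.instance Definition _ := [SubChoice_isSubLmodule of submod by <:].

End Submodule.

Section Complements.
Variable S : pzRingType.
Implicit Types U V W X : lmodType S.

(** An inverse function exists because modules are choice types. *)
Lemma linear_inj_surj_bij U V (f : {linear U -> V}) :
  (forall x, f x = 0 -> x = 0) -> (forall y, exists x, y = f x) -> bijective f.
Proof.
move=> f_inj f_surj.
have f_surjb y : exists x, y == f x by have [x ->] := f_surj y; exists x.
have fK y : f (xchoose (f_surjb y)) = y.
  by rewrite -(eqP (xchooseP (f_surjb y))).
exists (fun y => xchoose (f_surjb y)) => // x.
by apply/eqP; rewrite -subr_eq0; apply/eqP/f_inj; rewrite linearB fK subrr.
Qed.

Definition kerp U V (h : U -> V) : {pred U} := [pred x | h x == 0].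

Lemma kerp_closed U V (h : {linear U -> V}) : submod_closed (kerp h).
Proof.
split=> [|c x y]; rewrite !inE ?linear0 // => /eqP hx /eqP hy.
by rewrite linearP hx hy scaler0 addr0.
Qed.

(** The complement is the kernel of the retraction. *)
Lemma split_injection_complement U V (i : {linear U -> V})
    (r : {linear V -> U}) :
  cancel i r ->
  exists (W : lmodType S) (g : {linear dsum U W -> V}),
    bijective g /\ forall x, g (x, 0) = i x.
Proof.
move=> iK; exists (submod (kerp_closed r)).
exists (sumf i \val); split=> [|x]; last exact: addr0.
apply: linear_inj_surj_bij => [[x [y y_ker]] /= xy0|v].
  have /eqP ry0 : r y == 0 by [].
  have x0 : x = 0 by have := congr1 r xy0; rewrite linearD iK ry0 addr0 linear0.
  congr (_, _); first exact: x0.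
  by apply: val_inj; rewrite /= -xy0 x0 linear0 add0r.
have ker_v : v - i (r v) \in closed_pred (kerp_closed r).
  by rewrite inE linearB iK subrr.
by exists (r v, Submod ker_v); rewrite /= addrC subrK.
Qed.

(** If g' (f (u, 0)) = (v, w), then f (u, 0) = g (v, 0) + f (0, w), hence
    g (v, 0) = f (u, - w). *)
Lemma common_complement_cancel U W V X (f : {linear dsum U W -> X})
    (g : {linear dsum V W -> X}) (f' : X -> dsum U W) (g' : X -> dsum V W) :
  cancel f f' -> cancel g' g -> (forall w, f (0, w) = g (0, w)) ->
  forall u, (f' (g ((g' (f (u, 0))).1, 0))).1 = u.
Proof.
move=> fK g'K fg u; case def_g': (g' _) => [v w] /=.
suff -> : g (v, 0) = f (u, - w) by rewrite fK.
have {def_g'} /(congr1 g) := def_g'; rewrite g'K.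
have -> : (v, w) = (v, 0) + (0, w) :> dsum V W.
  by rewrite -[RHS]/(v + 0, 0 + w) addr0 add0r.
rewrite linearD -fg => /(congr1 (fun x => x - f (0, w))); rewrite addrK => <-.
by rewrite -linearB; congr (f _); rewrite -[LHS]/(u - 0, 0 - w) subr0 sub0r.
Qed.

(** Two complements U and V of the same summand W are isomorphic, through the
    projection of U to V along W. *)
Lemma common_complement_bij U W V X (f : {linear dsum U W -> X})
    (g : {linear dsum V W -> X}) (f' : X -> dsum U W) (g' : X -> dsum V W) :
  cancel f f' -> cancel f' f -> cancel g g' -> cancel g' g ->
  (forall w, f (0, w) = g (0, w)) ->
  bijective (fun u => (g' (f (u, 0))).1).
Proof.
move=> fK f'K gK g'K fg; exists (fun v => (f' (g (v, 0))).1) => x.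
  exact: (common_complement_cancel fK g'K fg).
exact: (common_complement_cancel gK f'K (fun w => esym (fg w))).
Qed.

End Complements.

Lemma sum_option_ord2 (V : nmodType) (F : option 'I_2 -> V) :
  \sum_o F o = F None + (F (Some 0) + F (Some 1)).
Proof.
rewrite (bigD1 None) //= (bigD1 (Some 0)) //= (bigD1 (Some 1)) //=.
by rewrite big1 ?addr0 // => [[[[|[]]]|]].
Qed.

(** * The exchange property and refinement *)

Section Exchange.
Variable S : pzRingType.
Hypothesis exchS : finite_exchange (S^o : lmodType S).
Implicit Types A B C D K : lmodType S.

(** A summand A of the regular module S inherits its exchange property. If
    S = D + A and A is a summand of K + B, then S is a summand of
    G = (D + K) + B, through the given embedding on A and the identity on D.
    Exchanging S there gives G = S + A'0 + A'1 with A'0 inside D + K; as S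
    contains D, the module A'0 may be replaced by its projection to K, and
    dividing by D yields the complement of A. *)
Lemma exchange_complement A D K B (f : {linear A -> dsum K B})
    (p : {linear dsum K B -> A}) :
  lmod_iso S^o (dsum D A) -> cancel f p ->
  exists (K1 B1 : lmodType S) (i : {linear K1 -> K}) (j : {linear B1 -> B}),
    bijective (sumf f (pairf (i \o fst) (j \o snd))
               : dsum A (dsum K1 B1) -> dsum K B).
Proof.
case/lmod_isoP=> phi [phi' [phiK phi'K]] fK.
(* h embeds S in G, with image the kernel of dev and complement the kernel
   of q. *)
pose G := dsum (dsum D K) B.
pose h := pairf (pairf (fst \o phi) (fst \o f \o snd \o phi))
                (snd \o f \o snd \o phi) : {linear S^o -> G}.
pose pr := pairf (snd \o fst) snd : {linear G -> dsum K B}.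
pose q := pairf (fst \o fst) (p \o pr) : {linear G -> dsum D A}.
pose dev := (f \o p \o pr) \- pr : {linear G -> dsum K B}.
have qh x : q (h x) = phi x.
  by rewrite /q /h /pr /= -surjective_pairing fK -surjective_pairing.
have h_inj : injective h.
  by move=> x y /(congr1 q); rewrite !qh => /(can_inj phiK).
have dev_h x : dev (h x) = 0.
  by rewrite /dev /h /pr /= -surjective_pairing fK subrr.
have h_onto x : dev x = 0 -> x = h (phi' (q x)).
  move/eqP; rewrite /dev /= subr_eq0 => /eqP fpx.
  rewrite /h /= phi'K /= fpx /pr /=.
  by case: x {fpx} => [[]].
have q_ker x : dev x = 0 -> q x = 0 -> x = 0.
  by move=> /h_onto x_im q0; rewrite x_im q0 !linear0.
have imM' x : x \in kerp dev <-> exists m, x = h m.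
  rewrite inE; split=> [/eqP/h_onto x_im | [m ->]]; last by rewrite dev_h.
  by exists (phi' (q x)).
have sumMN : is_direct_sum (fun b : bool => if b then kerp dev else kerp q).
  split=> [[]|x|u u_in].
  - exact: kerp_closed.
  - exact: kerp_closed.
  - exists (fun b : bool => if b then h (phi' (q x)) else x - h (phi' (q x))).
      case; rewrite inE; first by rewrite dev_h.
      by rewrite linearB qh phi'K subrr.
    by rewrite big_bool /= addrC subrK.
  rewrite big_bool /= => u0.
  have /eqP dev_t := u_in true; have /eqP q_f := u_in false.
  have ut0 : u true = 0.
    by apply: q_ker dev_t _; rewrite -(linear0 q) -u0 linearD q_f addr0.
  by case=> //; move: u0; rewrite ut0 add0r.
have sumDKB : is_direct_sum (fun i : 'I_2 =>
    if i == 0 then kerp (snd : G -> B) else kerp (fst : G -> dsum D K)).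
  split=> [i|x|u u_in].
  - by case: ifP => _; apply: kerp_closed.
  - exists (fun i => if i == 0 then (x.1, 0) else (0, x.2)).
      by move=> i; case: ifP; rewrite inE.
    rewrite !big_ord_recl big_ord0 addr0 /= -[RHS]/(x.1 + 0, 0 + x.2).
    by rewrite addr0 add0r -surjective_pairing.
  rewrite !big_ord_recl big_ord0 addr0 => u0.
  have /eqP u1 := u_in 0; have /eqP u2 := u_in (lift 0 0).
  have u00 : u ord0 = 0.
    have := congr1 fst u0; rewrite linearD /= u2 addr0 => u01.
    by move: u01 u1; case: (u 0) => x y /= -> ->.
  have u10 : u (lift ord0 ord0) = 0 by move: u0; rewrite u00 add0r.
  case=> [[|[|//]] lti]; [rewrite -u00 | rewrite -u10];
    by congr (u _); apply: val_inj.
have [A' subA' [clA' genA' indA']] := exchS h_inj imM' sumMN sumDKB.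
have A'0 x : x \in A' 0 -> x.2 = 0 by move/subA'; rewrite inE => /eqP.
have A'1 x : x \in A' 1 -> x.1 = 0 by move/subA'; rewrite inE => /eqP.
have cl0 : submod_closed (A' 0) := clA' (Some 0).
have cl1 : submod_closed (A' 1) := clA' (Some 1).
exists (submod cl0), (submod cl1), (snd \o (fst \o \val)), (snd \o \val).
have pr_h r : pr (h r) = f (phi r).2 by rewrite /pr /= -surjective_pairing.
apply: linear_inj_surj_bij => [[a [x y]] /= axy0 | kb].
  (* The D-coordinate of r is chosen to cancel that of x, which the
     projection of x to K forgets. *)
  pose r := phi' (- (\val x).1.1, a).
  pose u (o : option 'I_2) : G :=
    if o is Some i then if i == 0 then \val x else \val y else h r.
  have phir : phi r = (- (\val x).1.1, a) by rewrite phi'K.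
  have x2 := A'0 _ (valP x); have y1 := A'1 _ (valP y).
  have u0 : \sum_i u i = 0.
    rewrite sum_option_ord2 /u /=.
    have sum11 : (h r + (\val x + \val y)).1.1 = 0.
      by rewrite !linearD /= phir y1 /= addr0 addNr.
    have pr_sum : pr (h r + (\val x + \val y)) = 0.
      rewrite !linearD pr_h phir /= -axy0; congr (_ + _).
      by rewrite /pr /= x2 y1 -[LHS]/(_ + 0, 0 + _) addr0 add0r.
    by move: sum11 pr_sum; case: (h r + _) => [[d k] b] /= -> [-> ->].
  have u_in o : u o \in (if o is Some i then A' i else kerp dev).
    case: o => [i|]; last by rewrite inE dev_h.
    rewrite /u; case: eqP => [->|/eqP i0]; first exact: valP.
    rewrite (_ : i = 1); first exact: valP.
    by apply: val_inj; case: i i0 => [[|[|]]].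
  have {u_in u0} uo := indA' u u_in u0.
  have a0 : a = 0.
    have := congr1 snd phir.
    by rewrite -qh -[h r]/(u None) uo linear0.
  congr (_, (_, _)); first exact: a0.
    by apply: val_inj; apply: (uo (Some 0)).
  by apply: val_inj; apply: (uo (Some 1)).
have [u u_in sum_u] := genA' ((0, kb.1), kb.2).
have u00 : u (Some 0) \in closed_pred cl0 by apply: (u_in (Some 0)).
have u11 : u (Some 1) \in closed_pred cl1 by apply: (u_in (Some 1)).
have /eqP/h_onto uN := u_in None.
exists ((q (u None)).2, (Submod u00, Submod u11)) => /=.
have -> : kb = pr ((0, kb.1), kb.2) by case: kb {sum_u}.
have prN : pr (u None) = f (q (u None)).2 by rewrite {1}uN pr_h phi'K.
rewrite sum_u sum_option_ord2 !linearD prN; congr (_ + _).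
rewrite /pr /= (A'0 _ u00) (A'1 _ u11).
by rewrite -[LHS]/(_ + 0, 0 + _) addr0 add0r.
Qed.

(** The complement K1 + B1 of A has in K + B also the complement K2 + B2;
    hence A projects isomorphically onto K2 + B2 along K1 + B1, and is the
    graph of a linear map from K2 + B2 to K1 + B1. *)
Lemma exchange_split A D K B (f : {linear A -> dsum K B})
    (p : {linear dsum K B -> A}) :
  lmod_iso S^o (dsum D A) -> cancel f p ->
  exists (K1 K2 B1 B2 : lmodType S)
    (k : {linear dsum K1 K2 -> K}) (k' : {linear K -> dsum K1 K2})
    (b : {linear dsum B1 B2 -> B}) (b' : {linear B -> dsum B1 B2}),
  [/\ cancel k k' /\ cancel k' k, cancel b b' /\ cancel b' b,
      bijective (sumf f (pairf (k \o pairf fst \0) (b \o pairf snd \0))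
                 : dsum A (dsum K1 B1) -> dsum K B)
    & bijective (pairf (snd \o k' \o fst \o f) (snd \o b' \o snd \o f)
                 : A -> dsum K2 B2)].
Proof.
move=> SDA fK; have [K1 [B1 [i [j bij_th]]]] := exchange_complement SDA fK.
have [th' [thK th'K]] := linear_inverse bij_th.
have iK : cancel i (fst \o (snd \o (th' \o pairf idfun \0))).
  move=> x; rewrite -[LHS]/((th' (i x, 0)).2.1).
  rewrite (_ : (i x, 0) = sumf f (pairf (i \o fst) (j \o snd)) (0, (x, 0))).
    by rewrite thK.
  by rewrite /= !linear0 add0r.
have jK : cancel j (snd \o (snd \o (th' \o pairf \0 idfun))).
  move=> x; rewrite -[LHS]/((th' (0, j x)).2.2).
  rewrite (_ : (0, j x) = sumf f (pairf (i \o fst) (j \o snd)) (0, (0, x))).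
    by rewrite thK.
  by rewrite /= !linear0 add0r.
have [K2 [k [/linear_inverse[k' [kK k'K]] k_i]]] :=
  split_injection_complement iK.
have [B2 [b [/linear_inverse[b' [bK b'K]] b_j]]] :=
  split_injection_complement jK.
exists K1, K2, B1, B2, k, k', b, b'; split=> //.
  apply: eq_bij bij_th _ _ => [] [a [x y]].
  by rewrite /= k_i b_j.
pose g := pairf (k \o pairf (fst \o snd) (fst \o fst))
                (b \o pairf (snd \o snd) (snd \o fst))
  : {linear dsum (dsum K2 B2) (dsum K1 B1) -> dsum K B}.
pose g' x : dsum (dsum K2 B2) (dsum K1 B1) :=
  (((k' x.1).2, (b' x.2).2), ((k' x.1).1, (b' x.2).1)).
have gK : cancel g g' by case=> [[? ?] [? ?]]; rewrite /g' /g /= kK bK.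
have g'K : cancel g' g.
  case=> x y; rewrite /g' /g /= -!surjective_pairing k'K b'K //.
apply: eq_bij (common_complement_bij thK th'K gK g'K _) _ _ => [[x y]|a].
  by rewrite /g /= linear0 add0r k_i b_j.
by rewrite /g' /= !linear0 !addr0.
Qed.

Lemma refinement A C D K B :
  lmod_iso S^o (dsum D A) -> lmod_iso (dsum A C) (dsum K B) ->
  exists K1 K2 B1 B2 : lmodType S,
    [/\ lmod_iso K (dsum K1 K2), lmod_iso B (dsum B1 B2)
      & lmod_iso A (dsum K2 B2)].
Proof.
move=> SDA /lmod_isoP[h [h' [hK h'K]]].
have fK : cancel (h \o pairf idfun \0) (fst \o h') by move=> x; rewrite /= hK.
have [K1 [K2 [B1 [B2 [k [k' [b [b' [[kK k'K] [bK b'K] _ biso]]]]]]]]] :=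
  exchange_split SDA fK.
exists K1, K2, B1, B2; split; [by exists k', k|by exists b', b|].
by eexists; apply: biso.
Qed.

End Exchange.

(** * A common complement for the two decompositions *)

Section Bridge.
Variable S : pzRingType.

(** In M = (Q + A) + (B + K), the image of F is the graph L of (al, be) over
    A + K. The section tau spans a complement Y of B + K, and the retraction
    rho onto L, read in A + K, has as kernel a complement X of L; that
    rho \o tau is bijective says that X is also a complement of Y. The
    submodule Y is the graph over Q + A of the map to B which is be plus the
    identification of the two copies of U. The submodule X is spanned by the
    summand B0 of B and by the sums p + sg p, where p runs over the part of L
    above K + U and sg p lies in the part of Y above Q + U. *)
Lemma graph_bridge (Q A B K U A0 B0 : lmodType S)
    (al : {linear dsum A K -> Q}) (be : {linear dsum A K -> B}) :
  lmod_iso A (dsum U A0) -> lmod_iso B (dsum U B0) ->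
  lmod_iso (dsum K U) (dsum Q U) ->
  let F x : dsum (dsum Q A) (dsum B K) := ((al x, x.1), (be x, x.2)) in
  exists (tau : {linear dsum Q A -> dsum (dsum Q A) (dsum B K)})
    (rho : {linear dsum (dsum Q A) (dsum B K) -> dsum A K}),
    [/\ forall x, (tau x).1 = x, forall x, rho (F x) = x
      & bijective (rho \o tau)].
Proof.
move=> /lmod_isoP[iA' [iA [iA'K iAK]]] /lmod_isoP[iB' [iB [iB'K iBK]]].
move=> /lmod_isoP[sg [sg' [sgK sg'K]]] F.
pose M := dsum (dsum Q A) (dsum B K).
pose mQ := fst \o fst : {linear M -> Q}.
pose mA := snd \o fst : {linear M -> A}.
pose mB := fst \o snd : {linear M -> B}.
pose mK := snd \o snd : {linear M -> K}.
pose mAK := pairf mA mK : {linear M -> dsum A K}.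
(* Modulo L, an element of M has coordinates in Q and in B = U + B0. These
   determine its component in X along L, a sum of p + sg p and an element of
   B0: mU and mQ0 are the U- and Q-coordinates of sg p, and w is p. *)
pose mU := fst \o (iB' \o (mB \- (be \o mAK))) : {linear M -> U}.
pose mQ0 := (mQ \- (al \o mAK)) \+ (al \o pairf (iA \o pairf mU \0) \0)
  : {linear M -> Q}.
pose w := sg' \o pairf mQ0 mU : {linear M -> dsum K U}.
pose rho := pairf (mA \- (iA \o pairf (mU \+ (snd \o w)) \0)) (mK \- (fst \o w))
  : {linear M -> dsum A K}.
pose tau := pairf idfun
  (pairf ((be \o pairf snd \0) \+ (iB \o pairf (fst \o iA' \o snd) \0)) \0)
  : {linear dsum Q A -> M}.
have mUE x : mU x = (iB' (mB x - be (mAK x))).1 by [].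
have mQ0E x : mQ0 x = mQ x - al (mAK x) + al (iA (mU x, 0), 0) by [].
have wE x : w x = sg' (mQ0 x, mU x) by [].
have rhoE x : rho x = (mA x - iA (mU x + (w x).2, 0), mK x - (w x).1) by [].
have z2 (X Y : lmodType S) : (0, 0) = 0 :> dsum X Y by [].
exists tau, rho; split=> [//|[a k]|{F}].
  have mU0 : mU (F (a, k)) = 0 by rewrite mUE subrr linear0.
  have w0 : w (F (a, k)) = 0 by rewrite wE mQ0E mU0 subrr add0r !(z2, linear0).
  by rewrite rhoE w0 mU0 /= addr0 z2 linear0 !subr0.
have mU_tau q a : mU (tau (q, a)) = (iA' a).1.
  rewrite mUE -[mB _]/(be (a, 0) + iB ((iA' a).1, 0)) -[mAK _]/(a, 0 : K).
  by rewrite addrC addKr iBK.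
have iA_split a : iA (0, (iA' a).2) = a - iA ((iA' a).1, 0).
  apply: (can_inj iA'K); rewrite linearB !iAK.
  by case: (iA' a) => x y; rewrite -[RHS]/(x - x, y - 0) subrr subr0.
have al_split a b : al (a - b, 0) = al (a, 0) - al (b, 0).
  rewrite -linearB -[X in al X = _]/(a - b, 0).
  by congr (al (_, _)); rewrite subr0.
have mQ0_tau q a : mQ0 (tau (q, a)) = q - al (iA (0, (iA' a).2), 0).
  rewrite mQ0E mU_tau -[mAK _]/(a, 0 : K) iA_split al_split opprB.
  by rewrite -[mQ _]/q addrA addrAC.
have w_tau q a :
    w (tau (q, a)) = sg' (q - al (iA (0, (iA' a).2), 0), (iA' a).1).
  by rewrite wE mQ0_tau mU_tau.
have rho_tau q a : rho (tau (q, a)) =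
    (iA (- (w (tau (q, a))).2, (iA' a).2), - (w (tau (q, a))).1).
  rewrite rhoE mU_tau -[mK _]/(0 : K) sub0r -[mA _]/a; congr (_, _).
  rewrite -{1}[a]iA'K -linearB; congr (iA _).
  case: (iA' a) => x y /=; rewrite -[LHS]/(x - (x + _), y - 0) subr0.
  by rewrite opprD addrA subrr add0r.
apply: linear_inj_surj_bij => [[q a]|[a k]].
  rewrite -[X in X = 0 -> _]/(rho (tau (q, a))) rho_tau => rt0.
  have /eqP := congr1 snd rt0; rewrite oppr_eq0 => /eqP w1.
  have := congr1 (iA' \o fst) rt0; rewrite /= iAK linear0 => wa.
  have /eqP := congr1 fst wa; rewrite oppr_eq0 => /eqP w2.
  have a2 : (iA' a).2 = 0 := congr1 snd wa.
  have := w_tau q a; rewrite a2 !(z2, linear0) addr0.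
  rewrite [LHS]surjective_pairing w1 w2 z2 => /(congr1 sg).
  rewrite sg'K linear0 => qa; congr (_, _); first exact: esym (congr1 fst qa).
  rewrite -[LHS]iA'K [iA' a]surjective_pairing a2.
  by rewrite -[(iA' a).1](congr1 snd qa) z2 linear0.
pose y := iA' a; pose z := sg (- k, - y.1).
exists (z.1 + al (iA (0, y.2), 0), iA (z.2, y.2)).
rewrite -[RHS]/(rho (tau _)) rho_tau w_tau iAK /= addrK -surjective_pairing.
by rewrite sgK /= !opprK -surjective_pairing iA'K.
Qed.

End Bridge.

(** * Separative cancellation *)

Section Separative.
Variable S : pzRingType.
Hypothesis exchS : finite_exchange (S^o : lmodType S).
Hypothesis sepS : forall A B C : lmodType S, FP A -> FP B -> FP C ->
  lmod_iso (A * C * C)%type (B * C * C)%type ->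
  lmod_iso (A * C)%type (B * C)%type.

(** Here A0 is a part T2 of A which is a summand of K and of Q + U, and
    separativity cancels it in K + U + A0 = S = Q + U + A0. *)
Lemma common_summand (K A Q B : lmodType S) :
  lmod_iso S^o (dsum K A) -> lmod_iso S^o (dsum Q A) ->
  lmod_iso S^o (dsum K B) -> lmod_iso S^o (dsum Q B) ->
  exists U A0 B0 : lmodType S,
    [/\ lmod_iso A (dsum U A0), lmod_iso B (dsum U B0)
      & lmod_iso (dsum K U) (dsum Q U)].
Proof.
move=> KA QA KB QB.
have AKKB : lmod_iso (dsum A K) (dsum K B) by rewrite -KB KA dsumC.
(* K2 is the part of A below K, and B2 the part below B. *)
have [K1 [K2 [B1 [B2 [iK iB iA]]]]] := refinement exchS KA AKKB.
have S_K2 : lmod_iso S^o (dsum (dsum K B2) K2).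
  by rewrite KA iA (dsumC K2) dsumA.
have K2QB : lmod_iso (dsum K2 (dsum B2 Q)) (dsum (dsum Q B2) B1).
  by rewrite -dsumA (dsumC B2 B1) -iB -QB QA iA (dsumC Q) dsumA.
(* E2 is what can be moved from K2 to the part below B, as it embeds in the
   room B1 left there; the rest T2 embeds in Q + B2. *)
have [T1 [T2 [E1 [E2 [iT iE iK2]]]]] := refinement exchS S_K2 K2QB.
exists (dsum B2 E2), T2, E1; split.
- by rewrite iA iK2 (dsumC T2) dsumC dsumA.
- by rewrite iB iE (dsumC E1) dsumC dsumA.
have iX : lmod_iso (dsum (dsum (dsum K1 E2) (dsum B2 E2)) T2)
                   (dsum K (dsum B2 E2)).
  by rewrite (dsumC _ T2) iK iK2 !dsumA (dsumC T2 K1).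
have iY : lmod_iso (dsum (dsum T1 E2) T2) (dsum Q (dsum B2 E2)).
  by rewrite (dsumA Q) iT -dsumA (dsumC E2) dsumA.
have iA' : lmod_iso A (dsum (dsum B2 E2) T2).
  by rewrite iA iK2 (dsumC T2) dsumC dsumA.
have FP_K := FP_dsuml (FP_iso KA (FP_regular S)).
have FP_Q := FP_dsuml (FP_iso QB (FP_regular S)).
have FP_A := FP_dsumr (FP_iso KA (FP_regular S)).
have FP_TE := FP_iso iK2 (FP_dsuml (FP_iso iA FP_A)).
have FP_E2 := FP_dsumr FP_TE; have FP_T2 := FP_dsuml FP_TE.
have FP_B2 := FP_dsumr (FP_iso iA FP_A).
have FP_K1 := FP_dsuml (FP_iso iK FP_K).
have FP_T1 := FP_dsuml (FP_iso iT (FP_dsum FP_Q FP_B2)).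
rewrite -iX -iY; apply: sepS FP_T2 _; try by do !apply: FP_dsum.
suff : lmod_iso (dsum (dsum K (dsum B2 E2)) T2) (dsum (dsum Q (dsum B2 E2)) T2).
  by rewrite -{1}iX -iY.
by rewrite -(dsumA K) -(dsumA Q) -iA' -KA -QA.
Qed.

(** Exhibits U as a summand of itself, so that exchange_split applies to the
    whole regular module. *)
Lemma dsum0_iso (U : lmodType S) : lmod_iso U (dsum 'rV[S]_0 U).
Proof.
exists (pairf \0 idfun); exists snd => // [[z x]] /=.
by rewrite [z]thinmx0.
Qed.

(** The map psi is the inverse of the matrix to be reduced: it carries the
    standard decomposition L1 + L2 to coordinates in which B1 and B2 are the
    two factors. The section tau spans a complement of B2, and the kernel of
    rho is a complement of L1. *)
Lemma unit_corner (psi : {linear dsum S^o S^o -> dsum S^o S^o}) :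
  bijective psi ->
  exists (tau : {linear S^o -> dsum S^o S^o})
    (rho : {linear dsum S^o S^o -> S^o}),
    [/\ forall x, (tau x).1 = x, forall x, rho (psi (x, 0)) = x
      & bijective (rho \o tau)].
Proof.
move=> /linear_inverse[psi' [psiK psi'K]].
pose f := psi \o pairf idfun \0 : {linear S^o -> dsum S^o S^o}.
have fK : cancel f (fst \o psi') by move=> x; rewrite /= psiK.
have [Q [A [B [K [k [k' [b [b' []]]]]]]]] :=
  exchange_split exchS (dsum0_iso _) fK.
move=> [kK k'K] [bK b'K] /linear_inverse[th' [thK th'K]] bij_t.
have [s [tK sK]] := linear_inverse bij_t.
pose t := pairf (snd \o k' \o fst \o f) (snd \o b' \o snd \o f)
  : {linear S^o -> dsum A K}.
pose al := fst \o (k' \o (fst \o (f \o s))) : {linear dsum A K -> Q}.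
pose be := fst \o (b' \o (snd \o (f \o s))) : {linear dsum A K -> B}.
have SQA : lmod_iso S^o (dsum Q A) by exists k', k.
have SBK : lmod_iso S^o (dsum B K) by exists b', b.
have SAK : lmod_iso S^o (dsum A K) by exists t.
(* Q + B and the image of L2 under psi are two complements of L1. *)
have SQB : lmod_iso S^o (dsum Q B).
  pose g := psi \o pairf snd fst : {linear dsum S^o S^o -> dsum S^o S^o}.
  pose g' x := ((psi' x).2, (psi' x).1).
  pose h := sumf f (pairf (k \o pairf fst \0) (b \o pairf snd \0))
    \o pairf snd fst : {linear dsum (dsum Q B) S^o -> dsum S^o S^o}.
  pose h' := pairf snd fst \o th'
    : {linear dsum S^o S^o -> dsum (dsum Q B) S^o}.
  have gK : cancel g g' by case=> x y; rewrite /g /g' /= psiK.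
  have g'K : cancel g' g.
    by move=> x; rewrite /g /g' /= -surjective_pairing psi'K.
  have hK : cancel h h'.
    by case=> x y; rewrite -[LHS]/((th' _).2, (th' _).1) [th' _]thK.
  have h'K : cancel h' h.
    by move=> x; rewrite -[RHS]th'K [th' x]surjective_pairing.
  have gh w : g (0, w) = h (0, w) by rewrite /= !linear0 addr0.
  exists (fst \o (h' \o (g \o pairf idfun \0))).
  exact: (common_complement_bij gK g'K hK h'K gh).
have SKA : lmod_iso S^o (dsum K A) by rewrite dsumC.
have SKB : lmod_iso S^o (dsum K B) by rewrite dsumC.
have [U [A0 [B0 [iA iB iKQ]]]] := common_summand SKA SQA SKB SQB.
have [tau [rho [tau1 rhoF bij_rt]]] := graph_bridge al be iA iB iKQ.
exists (pairf (k \o fst) (b \o snd) \o (tau \o k')).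
exists (s \o (rho \o pairf (k' \o fst) (b' \o snd))); split=> [x|x|].
- by rewrite /= tau1 k'K.
- rewrite -[RHS]tK -[LHS]/(s (rho (k' (f x).1, b' (f x).2))); congr (s _).
  rewrite -[RHS]rhoF; congr (rho _).
  by rewrite /al /be /= tK -!surjective_pairing.
have bij_s : bijective s by exists t.
have bij_k' : bijective k' by exists k.
apply: eq_bij (bij_comp bij_s (bij_comp bij_rt bij_k')) _ _ => x.
by rewrite /= kK bK -surjective_pairing.
Qed.

End Separative.

(** * Matrices of size two *)

Section TwoByTwo.
Variable R : pzRingType.
Implicit Types (a b c d v w : R) (A B : 'M[R]_2).

Lemma mx2_mul a b c d a' b' c' d' :
  mx2 a b c d *m mx2 a' b' c' d' =
  mx2 (a * a' + b * c') (a * b' + b * d') (c * a' + d * c') (c * b' + d * d').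
Proof.
apply/matrixP => i j; rewrite !mxE !big_ord_recl big_ord0 addr0 !mxE /=.
by case: i => [[|[|]]] //= ?; case: j => [[|[|]]].
Qed.

Lemma mx2_eta A : A = mx2 (A 0 0) (A 0 1) (A 1 0) (A 1 1).
Proof.
apply/matrixP => i j; rewrite !mxE.
by case: i => [[|[|]]] //= ?; case: j => [[|[|]]] //= ?;
   congr (A _ _); apply: val_inj.
Qed.

Lemma mx2_scalar1 : 1%:M = mx2 1 0 0 1 :> 'M[R]_2.
Proof. by rewrite [LHS]mx2_eta !mxE. Qed.

Lemma mx2_inj a b c d a' b' c' d' :
  mx2 a b c d = mx2 a' b' c' d' -> [/\ a = a', b = b', c = c' & d = d'].
Proof.
move/matrixP=> e; move: (e 0 0) (e 0 1) (e 1 0) (e 1 1).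
by rewrite !mxE.
Qed.

Lemma mx2_diag a d : is_diag_mx (mx2 a 0 0 d).
Proof.
apply/is_diag_mxP => i j; rewrite mxE.
by case: i => [[|[|]]] //= ?; case: j => [[|[|]]].
Qed.

Lemma unit_corner_diag v w b c d :
  v * w = 1 -> w * v = 1 ->
  exists A3 D : 'M[R]_2, [/\ elementary_op (mx2 v b c d) A3,
    elementary_op A3 D & is_diag_mx D].
Proof.
move=> vw wv.
exists (mx2 v 0 c (d - c * (w * b))), (mx2 v 0 0 (d - c * (w * b))).
split; last exact: mx2_diag.
  exists (mx2 1 (- (w * b)) 0 1); first by exists (- (w * b)); left.
  right; rewrite mx2_mul !mulr0 !mulr1 !addr0 !mulrN (mulrA v) vw mul1r addNr.
  by rewrite [- _ + d]addrC.
exists (mx2 1 0 (- (c * w)) 1); first by exists (- (c * w)); right.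
left; rewrite mx2_mul !mul0r !mul1r !mulr0 !addr0 !add0r mulNr -mulrA wv mulr1.
by rewrite addNr.
Qed.

(** The endomorphisms of the right module R are the left multiplications. *)
Definition lmulr_map a (x : R^c^o) : R^c^o := a * (x : R).

Lemma lmulr_map_linear a : linear (lmulr_map a).
Proof.
move=> c x y.
by rewrite -[LHS]/(a * ((x : R) * (c : R) + y)) mulrDr mulrA.
Qed.

HB.instance Definition _ a :=
  GRing.isLinear.Build R^c R^c^o R^c^o *:%R (lmulr_map a) (lmulr_map_linear a).

Lemma linear_lmulr (f : {linear (R^c^o) -> (R^c^o)}) (x : R) :
  f x = ((f 1 : R) * x : R).
Proof.
rewrite -[RHS]/((x : R^c) *: f 1) -linearZ; congr (f _).
exact: esym (mul1r x).
Qed.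

Definition mx2_map A : {linear dsum R^c^o R^c^o -> dsum R^c^o R^c^o} :=
  pairf (sumf (lmulr_map (A 0 0)) (lmulr_map (A 0 1)))
        (sumf (lmulr_map (A 1 0)) (lmulr_map (A 1 1))).

Lemma mx2_mapK A B : B *m A = 1%:M -> cancel (mx2_map A) (mx2_map B).
Proof.
rewrite mx2_scalar1 {1}[A]mx2_eta {1}[B]mx2_eta mx2_mul.
move=> /mx2_inj[e00 e01 e10 e11].
case=> x y.
rewrite -[X in mx2_map B X]/(A 0 0 * x + A 0 1 * y, A 1 0 * x + A 1 1 * y).
have mulE u v : u * (A 0 0 * x + A 0 1 * y) + v * (A 1 0 * x + A 1 1 * y)
    = (u * A 0 0 + v * A 1 0) * x + (u * A 0 1 + v * A 1 1) * y :> R.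
  by rewrite !mulrDr !mulrDl !mulrA addrACA.
rewrite -[LHS]/(B 0 0 * (_ + _) + B 0 1 * (_ + _) : R,
                B 1 0 * (_ + _) + B 1 1 * (_ + _) : R).
by rewrite !mulE e00 e01 e10 e11 !mul1r !mul0r addr0 add0r.
Qed.

End TwoByTwo.

Theorem theorem6p11 (R : pzRingType) (hR : separative_exchange_ring R)
    (A : 'M[R]_2) (hA : GL2 A) :
  exists A1 A2 A3 D : 'M[R]_2,
    [/\ elementary_op A A1, elementary_op A1 A2, elementary_op A2 A3,
        elementary_op A3 D & is_diag_mx D].
Proof.
have [exchR sepR] := hR; have [B AB BA] := hA.
have bij_B : bijective (mx2_map B).
  by exists (mx2_map A); apply: mx2_mapK.
have [tau [rho [tau1 rhoB bij_rt]]] := unit_corner exchR sepR bij_B.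
(* tau spans the column (1, x)^T in the coordinates of B1 + B2, and rho is
   the row (l, m) in these coordinates. *)
pose x : R := (tau 1).2.
pose l : R := rho (1, 0).
pose m : R := rho (0, 1).
have rhoE (u v : R) : rho (u, v) = (l * u + m * v : R).
  have rho1 := linear_lmulr (rho \o pairf idfun \0) u.
  have rho2 := linear_lmulr (rho \o pairf \0 idfun) v.
  rewrite (_ : rho (u, v) = rho (u, 0) + rho (0, v)).
    by rewrite [X in X + _]rho1 [X in _ + X]rho2.
  by rewrite -linearD; congr (rho (_, _)); rewrite ?addr0 ?add0r.
pose v : R := l + m * x.
have rho_tau (r : R) : rho (tau r) = (v * r : R).
  rewrite [LHS](linear_lmulr (rho \o tau)) /= [tau 1]surjective_pairing tau1.
  by rewrite rhoE mulr1.
have [g [gK Kg]] := linear_inverse bij_rt.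
pose w : R := g 1.
have vw : v * w = 1 by rewrite -rho_tau; apply: (Kg 1).
have wv : w * v = 1.
  by rewrite -[LHS](linear_lmulr g) -[v]mulr1 -rho_tau; apply: (gK 1).
have lB : l * B 0 0 + m * B 1 0 = 1.
  rewrite -[RHS]rhoB -rhoE; congr (rho (_, _));
    by rewrite -[RHS]/(_ * 1 + _ * 0 : R) mulr1 mulr0 addr0.
pose y : R := l * B 0 1 + m * B 1 1.
move: BA; rewrite mx2_scalar1 {1}[B]mx2_eta {1}[A]mx2_eta mx2_mul.
case/mx2_inj=> e00 e01 e10 e11.
(* rho splits the first column of B, so (l, m) B = (1, y) and therefore
   (l, m) = (1, y) A: it is a row operation away from the first row of A. *)
have lmBE p q : l * (B 0 0 * p + B 0 1 * q) + m * (B 1 0 * p + B 1 1 * q)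
    = p + y * q.
  by rewrite !mulrDr !mulrA addrACA -!mulrDl lB mul1r.
have lE : A 0 0 + y * A 1 0 = l by rewrite -lmBE e00 e10 mulr1 mulr0 addr0.
have mE : A 0 1 + y * A 1 1 = m by rewrite -lmBE e01 e11 mulr1 mulr0 add0r.
have [A3 [D [opA3 opD diagD]]] :=
  unit_corner_diag m (A 1 0 + A 1 1 * x) (A 1 1) vw wv.
exists (mx2 l m (A 1 0) (A 1 1)), (mx2 v m (A 1 0 + A 1 1 * x) (A 1 1)), A3, D.
split=> //.
  exists (mx2 1 y 0 1); first by exists y; left.
  left; rewrite [X in _ = _ *m X](mx2_eta A) mx2_mul !mul0r !mul1r !add0r.
  by rewrite lE mE.
exists (mx2 1 0 x 1); first by exists x; right.
by right; rewrite mx2_mul !mulr0 !mulr1 !add0r.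
Qed.
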